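(* Let $p$ be an odd prime, set $N=(p-1)/2$, and let $\mathbb{F}_p=\mathbb{Z}/p\mathbb{Z}$. Then in the polynomial ring $\mathbb{F}_p[x,z]$ we have $$\sum_{r=0}^{N}\ \sum_{1\le m_1<\cdots<m_r\le N}\ \prod_{j=1}^{r}\left(\frac{x}{m_j}+\frac{2(-1)^jz}{m_j^2}\right)=\prod_{m=1}^N\left(1+\frac{x}{m}+\frac{z}{m^2}\right),$$ where the inner sum for $r=0$ consists of the empty tuple and the corresponding empty product is understood to be $1$.
   Context: The integers $m, m_j$ with $1\le m,m_j\le N<p$ are invertible modulo $p$, and $1/m$, $1/m_j^2$, etc. denote the corresponding inverses in $\mathbb{F}_p$. The inner sum runs over strictly increasing $r$-tuples of integers in $\{1,\ldots,N\}$. *)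

(* Defs.v *)
From HB Require Import structures.
From mathcomp Require Import all_boot all_order all_algebra.
From mathcomp Require Import mpoly.

Set Implicit Arguments.
Unset Strict Implicit.
Unset Printing Implicit Defensive.

(* 'I_N.+1 is {0, ..., N}, so positivity cuts the entries down to {1, ..., N}.
   Positions are numbered from 0: the entry m_j of the tuple (m_1, ..., m_r)
   is the value of m at the ordinal j - 1. *)
Definition increasing_tuple (N r : nat) (m : {ffun 'I_r -> 'I_N.+1}) : bool :=
  [forall j : 'I_r, 0 < m j]
  && [forall i : 'I_r, forall j : 'I_r, (i < j) ==> (m i < m j)].

(* Main.v *)
Require Import Defs.
From HB Require Import structures.
From mathcomp Require Import all_boot all_order all_algebra.
From mathcomp Require Import mpoly ring zify.

Set Implicit Arguments.
Unset Strict Implicit.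
Unset Printing Implicit Defensive.

Import GRing.Theory.
Local Open Scope ring_scope.

(** Why the identity holds.

    Let F_n be the sum over tuples with entries at most n, and D_n the same sum
    in which the term of an r-tuple carries the sign (-1)^r.  Appending a
    largest entry n to a tuple gives a linear recurrence of order one for the
    pair (F_n, D_n), because the sign of z in the new factor depends only on
    the parity of the length.  Eliminating D_n, the numbers G_n = n!^2 F_n
    satisfy the recurrence
      G_(n+1) = (2n^2 + 2n + 1 + x) G_n - (n^4 - n^2 x^2 + 4z^2) G_(n-1),
    so G_n is a continuant, that is, the determinant of a tridiagonal matrix
    (scaled_sums_three_term, det_jacobiE).

    Write x = a + b and z = ab, so that x^2 - 4z is a square; this costs
    nothing, the elementary symmetric polynomials being algebraically
    independent (mesym2_subst).  The coefficient n^4 - n^2 x^2 + 4z^2 then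
    factors as lower(n) * upper(n-1), where
      lower(n) = n^2 - n(a - b) - 2ab,   upper(n) = lower(-1 - n).
    Hence the tridiagonal matrix is a piece of the second-order difference
    operator L with quadratic coefficients
      (L f)(n) = (2n^2 + 2n + 1 + a + b) f(n)
                 - upper(n) f(n+1) - lower(n) f(n-1),
    which commutes with the reflection n -> -1 - n.  For an f that is odd under
    this reflection f(-1) = -f(0), which accounts for the corner -2z of the
    matrix; and modulo p = 2N + 1 the point N is fixed by the reflection, so
    that f(N) = 0 and the matrix of size N is exactly L on odd functions on
    the integers modulo p.

    L does not raise the degree of a polynomial.  On odd functions it is
    triangular in the basis phi_k (phi_triangular, jacobi_mul_phi), with
    diagonal entries (2k + 2 + 2a)(2b - 2k - 1) for k < N.  Modulo p one has
    -1 = 2N, hence the second factor is 2(N - k + b); since 2^(2N) = 1, the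
    product of these entries is the product of (m + a)(m + b) = m^2 + mx + z
    over 1 <= m <= N (prod_eigval), and dividing by N!^2 gives the claim. *)

(** * Sums over increasing tuples *)

Definition ffun_rcons (T : finType) r (k : T) (m : {ffun 'I_r -> T}) :
    {ffun 'I_r.+1 -> T} :=
  [ffun j => if unlift ord_max j is Some i then m i else k].

Lemma ffun_rcons_max (T : finType) r (k : T) (m : {ffun 'I_r -> T}) :
  ffun_rcons k m ord_max = k.
Proof. by rewrite ffunE unlift_none. Qed.

Lemma ffun_rcons_lift (T : finType) r (k : T) (m : {ffun 'I_r -> T}) i :
  ffun_rcons k m (lift ord_max i) = m i.
Proof. by rewrite ffunE liftK. Qed.

Lemma ffun_rcons_bij (T : finType) r :
  bijective (fun km : T * {ffun 'I_r -> T} => ffun_rcons km.1 km.2).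
Proof.
exists (fun f : {ffun 'I_r.+1 -> T} =>
          (f ord_max, [ffun i => f (lift ord_max i)])) => [[k m]|f] /=.
  rewrite ffun_rcons_max; congr pair; apply/ffunP => i.
  by rewrite ffunE ffun_rcons_lift.
apply/ffunP => j; case: (unliftP ord_max j) => [i|] ->.
  by rewrite ffun_rcons_lift ffunE.
by rewrite ffun_rcons_max.
Qed.

Section TupleSums.

Variables (R : comNzRingType) (N : nat) (w : nat -> nat -> R).

(** The codomain of the tuples stays ['I_N.+1] whatever the bound [n], so that
    the sums for different [n] range over one type. *)
Definition tuple_sum r n : R :=
  \sum_(m : {ffun 'I_r -> 'I_N.+1} |
          increasing_tuple m && [forall j, (m j <= n)%N])
     \prod_(j < r) w j (m j).

Lemma tuple_sum0 n : tuple_sum 0 n = 1.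
Proof.
rewrite /tuple_sum (eq_bigr (fun=> 1)) => [|m _]; last by rewrite big_ord0.
rewrite (eq_bigl xpredT) => [|m]; last first.
  rewrite /increasing_tuple.
  by apply/andP; split; [apply/andP; split|]; apply/forallP => -[].
by rewrite sumr_const card_ffun !card_ord.
Qed.

Lemma tuple_sum_full r :
  tuple_sum r N = \sum_(m : {ffun 'I_r -> 'I_N.+1} | increasing_tuple m)
                     \prod_(j < r) w j (m j).
Proof.
apply: eq_bigl => m; rewrite andbC; case: forallP => //= -[] j.
by rewrite -ltnS.
Qed.

Lemma increasing_rcons r n (k : 'I_N.+1) (m : {ffun 'I_r -> 'I_N.+1}) :
  increasing_tuple (ffun_rcons k m)
    && [forall j, (ffun_rcons k m j <= n)%N]
  = (0 < k <= n)%N && (increasing_tuple m && [forall j, (m j <= k.-1)%N]).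
Proof.
rewrite /increasing_tuple; apply/idP/idP.
  case/andP => /andP [/forallP pos /forallP inc] /forallP le_n.
  have := pos ord_max; have := le_n ord_max; rewrite !ffun_rcons_max => -> k0.
  rewrite k0 /=; apply/andP; split; first (apply/andP; split).
  - by apply/forallP => j; have := pos (lift ord_max j); rewrite ffun_rcons_lift.
  - apply/forallP => i; apply/forallP => j; have /forallP := inc (lift ord_max i).
    by move/(_ (lift ord_max j)); rewrite !ffun_rcons_lift !lift_max.
  apply/forallP => j; have /forallP/(_ ord_max) := inc (lift ord_max j).
  rewrite ffun_rcons_lift ffun_rcons_max lift_max /= ltn_ord /= => mk.
  by rewrite -ltnS (ltn_predK mk).
case/andP => /andP [k0 kn] /andP [/andP [/forallP pos /forallP inc] /forallP le_k].
have ltk j : (m j < k)%N by rewrite -(prednK k0) ltnS; exact: le_k.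
apply/andP; split; first (apply/andP; split).
- apply/forallP => j; case: (unliftP ord_max j) => [i|] ->.
    by rewrite ffun_rcons_lift.
  by rewrite ffun_rcons_max.
- apply/forallP => i; apply/forallP => j; apply/implyP.
  case: (unliftP ord_max i) => [i'|] ->; case: (unliftP ord_max j) => [j'|] ->.
  + rewrite !ffun_rcons_lift !lift_max => ij.
    by have /forallP/(_ j') := inc i'; rewrite ij.
  + by rewrite ffun_rcons_lift ffun_rcons_max.
  + by rewrite lift_max /= ltnNge ltnW.
  + by rewrite ltnn.
apply/forallP => j; case: (unliftP ord_max j) => [i|] ->.
  by rewrite ffun_rcons_lift; apply: leq_trans (ltnW (ltk i)) kn.
by rewrite ffun_rcons_max.
Qed.

(** Removing the last, hence largest, entry [k] leaves an increasing tuple with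
    entries below [k]. *)
Lemma tuple_sum_last r n :
  tuple_sum r.+1 n
  = \sum_(k : 'I_N.+1 | (0 < k <= n)%N) w r k * tuple_sum r k.-1.
Proof.
under [RHS]eq_bigr do rewrite /tuple_sum big_distrr /=.
rewrite pair_big_dep /= /tuple_sum.
rewrite (reindex _ (onW_bij _ (ffun_rcons_bij _ _))) /=.
apply: eq_big => [[k m]|[k m] _] /=; first exact: increasing_rcons.
rewrite big_ord_recr /= ffun_rcons_max mulrC; congr (_ * _).
apply: eq_bigr => i _.
have -> : widen_ord (leqnSn r) i = lift ord_max i.
  by apply: val_inj; rewrite /= /bump leqNgt ltn_ord.
by rewrite ffun_rcons_lift.
Qed.

Lemma tuple_sumS r n : (n < N)%N ->
  tuple_sum r.+1 n.+1 = tuple_sum r.+1 n + w r n.+1 * tuple_sum r n.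
Proof.
move=> ltnN; rewrite !tuple_sum_last (bigD1 (inord n.+1)) /=; last first.
  by rewrite inordK ?ltnS ?leqnn.
rewrite inordK ?ltnS // addrC; congr (_ + _); apply: eq_bigl => k.
by rewrite -val_eqE /= inordK ?ltnS //; lia.
Qed.

Lemma tuple_sum_gt r n : (n <= N)%N -> (n < r)%N -> tuple_sum r n = 0.
Proof.
elim: n r => [|n IHn] [|r] // nN nr.
  by rewrite tuple_sum_last big1 // => k; case: (k : nat).
by rewrite tuple_sumS // !IHn ?mulr0 ?addr0 //; lia.
Qed.

End TupleSums.

(** * The recurrences of the sums *)
Section Recurrence.

Variables (R : comNzRingType) (x z : R).

(** The pair (n!^2 F_n, n!^2 D_n), where F_n sums over all tuples with entries
    at most n and D_n weights an r-tuple by (-1)^r; see [scaled_tuple_sums].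
    The factor n!^2 clears all denominators. *)
Fixpoint scaled_sums n : R * R :=
  if n is n'.+1 then
    (n%:R * (n%:R + x) * (scaled_sums n').1 - 2%:R * z * (scaled_sums n').2,
     n%:R * (n%:R - x) * (scaled_sums n').2 + 2%:R * z * (scaled_sums n').1)
  else (1, 1).

(** Elimination of the second component: the first recurrence at [n] expresses
    [2 z D] through the values of the first component at [n] and [n.+1]. *)
Lemma scaled_sums_three_term n :
  (scaled_sums n.+2).1
  = (2%:R * n.+1%:R ^+ 2 + 2%:R * n.+1%:R + 1 + x) * (scaled_sums n.+1).1
    - (n.+1%:R ^+ 4 - n.+1%:R ^+ 2 * x ^+ 2 + 4%:R * z ^+ 2) * (scaled_sums n).1.
Proof. rewrite /=; ring. Qed.

(** A tuple with entries at most [n.+1] either avoids [n.+1] or ends with it.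
    In the second case the new factor has sign (-1)^(r+1) in front of [z] when
    [r] entries precede it, and this sign turns [e ^+ r] into [(- e) ^+ r].
    Taking [e = 1] and [e = -1] gives the closed system of [scaled_sums]. *)
Lemma signed_sumS N (w : nat -> nat -> R) (e : R) n :
  (forall r m, (0 < m <= N)%N ->
     m%:R ^+ 2 * w r m = m%:R * x + 2%:R * (-1) ^+ r.+1 * z) ->
  (n < N)%N ->
  n.+1%:R ^+ 2 * (\sum_(r < n.+2) e ^+ r * tuple_sum N w r n.+1)
  = n.+1%:R * (n.+1%:R + e * x) * (\sum_(r < n.+1) e ^+ r * tuple_sum N w r n)
    - 2%:R * e * z * (\sum_(r < n.+1) (- e) ^+ r * tuple_sum N w r n).
Proof.
move=> wE ltnN.
(* No strictly increasing tuple of length n+1 has all its entries in 1..n. *)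
have top0 : tuple_sum N w n.+1 n = 0 by rewrite tuple_sum_gt // ltnW.
have -> : \sum_(r < n.+2) e ^+ r * tuple_sum N w r n.+1
  = \sum_(r < n.+1) e ^+ r * tuple_sum N w r n
    + \sum_(r < n.+1) e ^+ r.+1 * (w r n.+1 * tuple_sum N w r n).
  rewrite big_ord_recl tuple_sum0 /=.
  under eq_bigr do rewrite /bump /= add1n tuple_sumS // mulrDr.
  rewrite big_split /= addrA; congr (_ + _).
  by rewrite big_ord_recr /= top0 mulr0 addr0 [RHS]big_ord_recl tuple_sum0.
rewrite mulrDr mulrDr mulrDl -addrA expr2; congr (_ + _).
rewrite !mulr_sumr -sumrB; apply: eq_bigr => r _.
have -> : n.+1%:R * n.+1%:R * (e ^+ r.+1 * (w r n.+1 * tuple_sum N w r n))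
   = e ^+ r.+1 * (n.+1%:R ^+ 2 * w r n.+1) * tuple_sum N w r n by ring.
rewrite wE ?ltnN // [(- e) ^+ r]exprNn !exprS; ring.
Qed.

Lemma scaled_tuple_sums N (w : nat -> nat -> R) n :
  (forall r m, (0 < m <= N)%N ->
     m%:R ^+ 2 * w r m = m%:R * x + 2%:R * (-1) ^+ r.+1 * z) ->
  (n <= N)%N ->
  (n`!%:R ^+ 2 * (\sum_(r < n.+1) 1 ^+ r * tuple_sum N w r n),
   n`!%:R ^+ 2 * (\sum_(r < n.+1) (-1) ^+ r * tuple_sum N w r n))
  = scaled_sums n.
Proof.
move=> wE; elim: n => [|n IHn] leN.
  by rewrite !big_ord_recl !big_ord0 !tuple_sum0 fact0 !expr0 !addr0 !mulr1 expr1n.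
have fE : n.+1`!%:R ^+ 2 = n`!%:R ^+ 2 * n.+1%:R ^+ 2 :> R.
  by rewrite factS natrM exprMn mulrC.
rewrite /= -(IHn (ltnW leN)) /= fE -2!(mulrA (_ ^+ 2)) !signed_sumS // opprK.
by congr pair; ring.
Qed.

End Recurrence.

(** * Tridiagonal determinants *)
Section Tridiagonal.

Variable R : comNzRingType.

Definition tridiag (l d u : nat -> R) n : 'M[R]_n :=
  \matrix_(i, j) (d i *+ (j == i :> nat) + u i *+ (j == i.+1 :> nat)
                  + l i *+ (j.+1 == i :> nat)).

Lemma sum_ord_pick n (c : R) (f : nat -> R) k :
  \sum_(j < n) (c *+ (j == k :> nat)) * f j = if (k < n)%N then c * f k else 0.
Proof.
case: ltnP => [kn|nk].
  rewrite (bigD1 (Ordinal kn)) //= eqxx mulr1n big1 ?addr0 // => j.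
  by rewrite -val_eqE /= => /negbTE ->; rewrite mulr0n mul0r.
rewrite big1 // => j _; rewrite ltn_eqF ?mulr0n ?mul0r //.
exact: leq_trans nk.
Qed.

(** Laplace expansion along the last row, then along the last column of the
    minor at position (n+1, n). *)
Lemma det_tridiag l d u n :
  \det (tridiag l d u n.+2)
  = d n.+1 * \det (tridiag l d u n.+1)
    - l n.+1 * u n * \det (tridiag l d u n).
Proof.
rewrite (expand_det_row _ ord_max) big_ord_recr /= big_ord_recr /= big1 ?add0r.
  rewrite addrC; congr (_ + _).
    rewrite mxE /= eqxx ltn_eqF // gtn_eqF // mulr0n !addr0 mulr1n.
    congr (_ * _).
    rewrite /cofactor -signr_odd addnn odd_double expr0 mul1r; congr (\det _).
    by apply/matrixP => i j; rewrite !mxE !lift_max.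
  rewrite mxE /= ltn_eqF // (ltn_eqF (leqnSn _)) // eqxx mulr0n mulr1n !add0r.
  rewrite -mulrA -mulrN; congr (_ * _).
  rewrite /cofactor /= addSn -signr_odd /= addnn odd_double /= expr1 mulN1r.
  congr (- _).
  rewrite (expand_det_col _ ord_max) big_ord_recr /= big1 ?add0r.
    rewrite !mxE /= /bump leqnn ltnn /= add1n add0n eqxx gtn_eqF // gtn_eqF //.
    rewrite mulr0n mulr1n add0r addr0; congr (_ * _).
    rewrite /cofactor -signr_odd addnn odd_double expr0 mul1r; congr (\det _).
    apply/matrixP => i j; rewrite !mxE !lift_max /= /bump.
    have nj : (n <= j)%N = false by rewrite leqNgt ltn_ord.
    by rewrite !nj !add0n ?nj ?add0n.
  move=> i _; rewrite !mxE /= /bump leqnn leqNgt ltnS (ltnW (ltn_ord i)) add0n add1n.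
  have := ltn_ord i => hi.
  by rewrite !gtn_eqF ?mulr0n ?addr0 ?mul0r //; lia.
move=> i _; rewrite !mxE /=; have := ltn_ord i => hi.
by rewrite !ltn_eqF ?mulr0n ?addr0 ?mul0r //; lia.
Qed.
End Tridiagonal.

(** * The difference operator and its triangular form *)
Section Spectrum.

Variables (R : comNzRingType) (a b : R).

Definition upper (y : R) := (y + 1) ^+ 2 + (y + 1) * (a - b) - 2%:R * a * b.
Definition lower (y : R) := y ^+ 2 - y * (a - b) - 2%:R * a * b.
Definition center (y : R) := 2%:R * y ^+ 2 + 2%:R * y + 1 + (a + b).

(** In the variable t = y + 1/2, [phi k] is twice the monic odd polynomial with
    roots 0 and the values +t and -t for y = 0, ..., k-1.  Placing the roots
    there makes the matrix of values [phi k i%:R] triangular. *)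
Definition psi k (y : R) := \prod_(i < k) ((y - i%:R) * (y + i.+1%:R)).
Definition phi k (y : R) := (2%:R * y + 1) * psi k y.

Definition eigval k : R :=
  (2%:R * k%:R + 2%:R + 2%:R * a) * (2%:R * b - 2%:R * k%:R - 1).
Definition offdiag k : R :=
  - (2%:R * k%:R * (2%:R * k%:R + 1)
     * (k%:R ^+ 2 + k%:R * (a - b) - 2%:R * a * b)).

Lemma psiS k y : psi k.+1 y = psi k y * ((y - k%:R) * (y + k.+1%:R)).
Proof. by rewrite /psi big_ord_recr. Qed.

(** Shifting [y] moves the window of 2k+2 consecutive linear factors by one, so
    the product keeps all factors of [psi k y] and two more. *)
Lemma psi_up k y :
  psi k.+1 (y + 1) = psi k y * ((y + k.+1%:R) * (y + k.+2%:R)).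
Proof.
elim: k => [|k IHk]; first by rewrite psiS /psi !big_ord0; ring.
rewrite psiS IHk psiS; ring.
Qed.

Lemma psi_down k y :
  psi k.+1 (y - 1) = psi k y * ((y - k%:R) * (y - k.+1%:R)).
Proof.
elim: k => [|k IHk]; first by rewrite psiS /psi !big_ord0; ring.
rewrite psiS IHk psiS; ring.
Qed.

(** [L] preserves parity and does not raise the degree, so [L (phi k)] is a
    combination of the [phi j] with [j <= k]; evaluating at y = 0, ..., k-2,
    where [phi k] vanishes at y and both neighbours, shows that only [k] and
    [k.-1] occur.  For [k = 0] the default [k.-1 = 0] is
    harmless as [offdiag 0 = 0]. *)
Lemma phi_triangular k y :
  center y * phi k y - upper y * phi k (y + 1) - lower y * phi k (y - 1)
  = eigval k * phi k y + offdiag k * phi k.-1 y.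
Proof.
case: k => [|k].
  rewrite /phi /psi !big_ord0 /center /upper /lower /eigval /offdiag; ring.
rewrite /phi psi_up psi_down psiS /center /upper /lower /eigval /offdiag /=; ring.
Qed.

Lemma phi_reflect k y : phi k (- 1 - y) = - phi k y.
Proof.
rewrite /phi -mulNr; congr (_ * _); first by ring.
by apply: eq_bigr => i _; ring.
Qed.

Lemma phi_eq0 k i : (i < k)%N -> phi k i%:R = 0.
Proof.
by move=> ik; rewrite /phi /psi (bigD1 (Ordinal ik)) //= subrr !mul0r mulr0.
Qed.

Lemma phi_diag k :
  phi k k%:R = (k.*2.+1 * \prod_(i < k) ((k - i) * (k + i.+1)))%N%:R.
Proof.
rewrite natrM natr_prod /phi -[_.*2.+1%:R]natr1 -mul2n natrM; congr (_ * _).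
apply: eq_bigr => i _; rewrite natrM natrD natrB //; exact: ltnW.
Qed.

(** The matrix of [L] on functions on 0, ..., n-1 extended by f(-1) = - f(0) and
    f(n) = 0.  The corner correction is [lower 0 = - 2ab], transported from the
    missing position -1 to position 0. *)
Definition jacobi :=
  tridiag (fun i => - lower i%:R)
          (fun i => center i%:R - 2%:R * a * b *+ (i == 0))
          (fun i => - upper i%:R).

(** Both sides satisfy the same recurrence of order two, since
    [lower (n+1) * upper n = (n+1)^4 - (n+1)^2 (a+b)^2 + 4 (ab)^2]. *)
Lemma det_jacobiE n : \det (jacobi n) = (scaled_sums (a + b) (a * b) n).1.
Proof.
elim/ltn_ind: n => -[|[|n]] IHn.
- by rewrite det_mx00.
- rewrite det_mx11 mxE /= !mulr0n !mulr1n /center; ring.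
rewrite det_tridiag -!/(jacobi _) !IHn // scaled_sums_three_term mulr0n.
move: (scaled_sums _ _ _).1 (scaled_sums _ _ _).1 => G1 G0.
rewrite /center /upper /lower; ring.
Qed.

(** When 2n + 1 = 0 every [phi k] satisfies the two boundary conditions built
    into [jacobi n]: it is odd under reflection, and the point [n] is fixed by
    the reflection, so [phi_triangular] holds row by row. *)
Lemma jacobi_mul_phi n : n.*2.+1%:R = 0 :> R ->
  jacobi n *m (\matrix_(i, k) phi k i%:R)
  = (\matrix_(i, k) phi k i%:R)
    *m tridiag (fun=> 0) eigval (fun k => offdiag k.+1) n.
Proof.
move=> n0; have phin k : phi k n%:R = 0.
  by rewrite /phi -natrM mul2n natr1 n0 mul0r.
apply/matrixP => i k; rewrite !mxE.
(* Both sides equal L (phi k) at i. *)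
transitivity (eigval k * phi k i%:R + offdiag k * phi k.-1 i%:R).
  rewrite -phi_triangular.
  under eq_bigr do rewrite !mxE !mulrDl.
  rewrite !big_split /= !(sum_ord_pick _ _ (fun j => phi k j%:R)) ltn_ord.
  have -> : (if (i.+1 < n)%N then - upper i%:R * phi k i.+1%:R else 0)
            = - upper i%:R * phi k (i%:R + 1).
    (* In the last row the omitted entry multiplies phi k n = 0. *)
    rewrite natr1; case: ltnP => // ni.
    have -> : i.+1 = n by apply/eqP; rewrite eqn_leq ltn_ord.
    by rewrite phin mulr0.
  case: (nat_of_ord i) (ltn_ord i) => [|j] jn.
    rewrite big1 ?addr0 => [|l _]; last by rewrite mulr0n mul0r.
    (* Row 0: the corner term supplies the value at -1 by oddness. *)
    have -> : phi k (0%:R - 1) = - phi k 0%:R by rewrite -phi_reflect; congr phi; ring.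
    rewrite mulr1n /lower; ring.
  under [X in _ + X]eq_bigr do rewrite eqSS.
  rewrite (sum_ord_pick _ _ (fun j => phi k j%:R)) ltnW // mulr0n.
  have -> : j.+1%:R - 1 = j%:R :> R by rewrite -natr1 addrK.
  ring.
under [RHS]eq_bigr => j _.
  rewrite !mxE mul0rn addr0 mulrDr ![phi j _ * _]mulrC (eq_sym (k : nat)).
  over.
rewrite big_split /=.
rewrite (eq_bigr (fun j : 'I_n => (eigval k *+ (j == k :> nat)) * phi j i%:R)); last first.
  by move=> j _; case: eqP => [->|].
rewrite (sum_ord_pick _ _ (fun j => phi j i%:R)) ltn_ord; congr (_ + _).
rewrite (eq_bigr (fun j : 'I_n => (offdiag k *+ (j.+1 == k :> nat)) * phi j i%:R)); last first.
  by move=> j _; rewrite (eq_sym (k : nat)); case: eqP => [->|].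
case: (nat_of_ord k) (ltn_ord k) => [|l] ln.
  rewrite big1 => [|j _]; last by rewrite mulr0n mul0r.
  by rewrite /offdiag mulr0 !mul0r oppr0 mul0r.
under eq_bigr do rewrite eqSS.
by rewrite (sum_ord_pick _ _ (fun j => phi j i%:R)) ltnW.
Qed.

End Spectrum.

(** * Evaluation in characteristic p = 2N + 1 *)
Section Determinant.

Variables (R : idomainType) (p N : nat).
Hypotheses (pcharR : p \in [pchar R]) (pE : p = N.*2.+1).
Variables a b : R.

Lemma natr_small_neq0 k : (0 < k < p)%N -> k%:R != 0 :> R.
Proof.
by case/andP=> k0 kp; rewrite -(dvdn_pcharf pcharR) gtnNdvd.
Qed.

Lemma prod_natr_neq0 I (r : seq I) (P : pred I) (F : I -> nat) :
  (forall i, P i -> (F i)%:R != 0 :> R) -> (\prod_(i <- r | P i) F i)%N%:R != 0 :> R.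
Proof.
move=> F0; rewrite natr_prod; apply: (big_ind (fun y => y != 0)) => //.
  exact: oner_neq0.
by move=> ? ? ? ?; rewrite mulf_neq0.
Qed.

Lemma phi_diag_neq0 k : (k < N)%N -> phi k k%:R != 0 :> R.
Proof.
move=> kN; rewrite phi_diag natrM mulf_neq0 //.
  by rewrite natr_small_neq0 // pE; lia.
apply: prod_natr_neq0 => i _; rewrite natrM mulf_neq0 //.
  by rewrite natr_small_neq0 // pE subn_gt0 ltn_ord; lia.
by rewrite natr_small_neq0 // pE; have := ltn_ord i; lia.
Qed.

(** The matrix of values of the [phi k] is lower triangular, with a diagonal
    that does not vanish because all integer factors are below [p]; hence it can
    be cancelled from the determinant of [jacobi_mul_phi]. *)
Lemma det_jacobi_eigval : \det (jacobi a b N) = \prod_(k < N) eigval a b k.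
Proof.
have n0 : N.*2.+1%:R = 0 :> R by rewrite -pE (pcharf0 pcharR).
set V : 'M[R]_N := \matrix_(i, k) phi k i%:R.
have trV : is_trig_mx V.
  by apply/is_trig_mxP => i j ij; rewrite mxE phi_eq0.
have detV : \det V != 0.
  rewrite det_trig //; apply/prodf_neq0 => i _.
  by rewrite mxE phi_diag_neq0.
apply: (mulIf detV); rewrite -det_mulmx jacobi_mul_phi // det_mulmx mulrC.
congr (_ * _); rewrite -det_tr det_trig.
  apply: eq_bigr => i _; rewrite !mxE eqxx ltn_eqF // mulr0n mulr1n mul0rn.
  by rewrite !addr0.
apply/is_trig_mxP => i j ij; rewrite !mxE mul0rn addr0.
by rewrite ltn_eqF // ltn_eqF ?ltnS 1?ltnW // !mulr0n addr0.
Qed.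

Lemma natr2_exp : 2%:R ^+ N.*2 = 1 :> R.
Proof.
have [->|N0] := posnP N; first by rewrite expr0.
have two0 : 2%:R != 0 :> R by rewrite natr_small_neq0 // pE; lia.
apply: (mulfI two0); rewrite mulr1 -exprS -pE.
exact: (pFrobenius_aut_nat pcharR 2).
Qed.

(** From 2N + 1 = 0 the factor 2b - 2k - 1 equals 2(N - k + b); reversing the
    order of these factors and using 2^(2N) = 1 gives the product. *)
Lemma prod_eigval :
  \prod_(k < N) eigval a b k = \prod_(1 <= m < N.+1) ((m%:R + a) * (m%:R + b)).
Proof.
have n0 : 2%:R * N%:R + 1 = 0 :> R.
  by rewrite -natrM natr1 mul2n -pE (pcharf0 pcharR).
have eigvalE (k : 'I_N) :
    eigval a b k = 2%:R ^+ 2 * ((k.+1%:R + a) * ((rev_ord k).+1%:R + b)).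
  rewrite /= subnSK // natrB 1?ltnW // /eigval.
  have -> : 2%:R * b - 2%:R * k%:R - 1
            = 2%:R * (N%:R - k%:R + b) - (2%:R * N%:R + 1) :> R by ring.
  by rewrite n0 subr0; ring.
rewrite (eq_bigr _ (fun k _ => eigvalE k)) big_split /= prodr_const card_ord.
rewrite -exprM mul2n natr2_exp mul1r big_split /=.
have -> : \prod_(k < N) ((rev_ord k).+1%:R + b) = \prod_(k < N) (k.+1%:R + b).
  by rewrite [RHS](reindex_inj rev_ord_inj).
by rewrite -big_split big_add1 big_mkord.
Qed.

Lemma scaled_sums_factor :
  (scaled_sums (a + b) (a * b) N).1
  = \prod_(1 <= m < N.+1) (m%:R ^+ 2 + m%:R * (a + b) + a * b).
Proof.
rewrite -det_jacobiE det_jacobi_eigval prod_eigval.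
by apply: eq_bigr => m _; ring.
Qed.

End Determinant.

(** * Passing from a, b to x, z *)
Lemma rmorph_scaled_sums (R S : comNzRingType) (f : {rmorphism R -> S}) (x z : R) n :
  (f (scaled_sums x z n).1, f (scaled_sums x z n).2) = scaled_sums (f x) (f z) n.
Proof.
elim: n => [|n IHn]; first by rewrite /= rmorph1.
by rewrite /= -IHn /= !(rmorph_nat, rmorphB, rmorphD, rmorphM).
Qed.

(** Substituting elementary symmetric polynomials is injective by the uniqueness
    part of the fundamental theorem of symmetric polynomials; so an identity in
    x and z may be checked after setting x = a + b and z = ab. *)
Lemma mesym2_subst (F : idomainType) (s := [tuple mesym 2 F i.+1 | i < 2]) :
  [/\ injective (comp_mpoly s), 'X_0 \mPo s = 'X_0 + 'X_1 :> {mpoly F[2]}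
   & 'X_1 \mPo s = 'X_0 * 'X_1 :> {mpoly F[2]}].
Proof.
split.
- exact: msym_fundamental_un.
- rewrite comp_mpolyXU -tnth_nth tnth_mktuple mesym1E !big_ord_recl big_ord0 addr0.
  by congr ('X_ _ + 'X_ _); apply: val_inj.
rewrite comp_mpolyXU -tnth_nth tnth_mktuple /= mesymnnE !big_ord_recl big_ord0 mulr1.
by congr ('X_ _ * 'X_ _); apply: val_inj.
Qed.

Theorem theorem1p1 (p N : nat) (p_prime : prime p) (p_odd : odd p)
    (N_def : N = ((p - 1) %/ 2)%N) :
  let x : {mpoly 'F_p[2]} := 'X_0 in
  let z : {mpoly 'F_p[2]} := 'X_1 in
  \sum_(0 <= r < N.+1)
     \sum_(m : {ffun 'I_r -> 'I_N.+1} | increasing_tuple m)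
        \prod_(j < r) ((m j)%:R^-1 *: x
                       + (2%:R * (-1) ^+ j.+1 / (m j)%:R ^+ 2) *: z)
  = \prod_(1 <= k < N.+1) (1 + k%:R^-1 *: x + (k%:R ^+ 2)^-1 *: z).
Proof.
move=> x z.
have pE : p = N.*2.+1 by rewrite N_def; lia.
have pcharF : p \in [pchar 'F_p] by exact: pchar_Fp.
have pcharR : p \in [pchar {mpoly 'F_p[2]}] by rewrite pchar_lalg.
have unitF m : (0 < m <= N)%N -> m%:R != 0 :> 'F_p.
  by move=> mN; apply: (natr_small_neq0 pcharF); lia.
pose w r m : {mpoly 'F_p[2]} :=
  m%:R^-1 *: x + (2%:R * (-1) ^+ r.+1 / m%:R ^+ 2) *: z.
have natZ (n : nat) (q : {mpoly 'F_p[2]}) : n%:R * q = n%:R *: q.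
  by rewrite scaler_nat mulr_natl.
have sqrZ (n : nat) (q : {mpoly 'F_p[2]}) : n%:R ^+ 2 * q = n%:R ^+ 2 *: q.
  by rewrite -natrX natZ natrX.
have wE r m : (0 < m <= N)%N ->
    m%:R ^+ 2 * w r m = m%:R * x + 2%:R * (-1) ^+ r.+1 * z.
  move=> mN; have m0 := unitF m mN.
  rewrite sqrZ /w scalerDr !scalerA natZ; congr (_ *: x + _).
    by rewrite expr2 mulfK.
  rewrite mulrC divfK ?expf_neq0 // -mulrA natZ -scalerA; congr (_ *: _).
  by rewrite -signr_odd scaler_sign -mulr_sign signr_odd.
have fact0 : N`!%:R ^+ 2 != 0 :> {mpoly 'F_p[2]}.
  rewrite expf_neq0 // fact_prod big_nat.
  apply: prod_natr_neq0 => m mN; apply: (natr_small_neq0 pcharR); lia.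
apply: (mulfI fact0).
transitivity (scaled_sums x z N).1.
  rewrite -(scaled_tuple_sums wE (leqnn N)) /=; congr (_ * _).
  rewrite big_mkord; apply: eq_bigr => r _.
  by rewrite expr1n mul1r tuple_sum_full.
transitivity (\prod_(1 <= m < N.+1) (m%:R ^+ 2 + m%:R * x + z)); last first.
  rewrite fact_prod natr_prod -prodrXl -big_split !big_nat /=.
  apply: eq_bigr => m mN; have m0 := unitF m mN.
  rewrite !mulrDr mulr1 !sqrZ !scalerA divff ?expf_neq0 // scale1r natZ.
  by rewrite expr2 mulfK.
have [inj sx sz] := mesym2_subst 'F_p.
apply: inj; rewrite rmorph_prod /=.
have /(congr1 fst) /= -> := rmorph_scaled_sums
  (comp_mpoly [tuple mesym 2 'F_p i.+1 | i < 2]) x z N.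
rewrite sx sz (scaled_sums_factor pcharR pE); apply: eq_bigr => m _.
by rewrite !rmorphD !rmorphM /= sx sz !rmorph_nat expr2.
Qed.
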